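(* Let $K$ be a field, $R=K[x_1,\dots,x_n]$, and let $I\subseteq R$ be a squarefree monomial ideal. Let $\mathbf a\in\mathbb N^n$ and let $k\ge1$ be an integer. Then $x^{\mathbf a}\in I^{(k)}$ if and only if $\tau_{\mathbf a}(I)\ge k$.
   Context: $\mathbb N$ includes $0$; $x^{\mathbf a}=x_1^{\alpha_1}\cdots x_n^{\alpha_n}$ for $\mathbf a=(\alpha_1,\dots,\alpha_n)$. $I^{(k)}$ is the $k$-th symbolic power of $I$, i.e. $I^{(k)}=\bigcap_{P\in\mathrm{Min}(I)}(I^kR_P\cap R)$, where $\mathrm{Min}(I)$ is the set of minimal primes of $I$; for squarefree monomial $I$ this equals $\bigcap_{P\in\mathrm{Min}(I)}P^k$. Let $x^{\mathbf a_1},\dots,x^{\mathbf a_m}$ be the minimal monomial generators of $I$ and $M$ the $n\times m$ matrix with columns $\mathbf a_1,\dots,\mathbf a_m$. Let $\mathbf 1^m=(1,\dots,1)\in\mathbb N^m$; vector inequalities are coordinatewise. Define $$\tau_{\mathbf a}(I)=\min\{\mathbf a\cdot\mathbf z\mid\mathbf z\in\mathbb N^n,\ M^T\mathbf z\ge\mathbf 1^m\},$$ with the convention $\tau_{\mathbf a}(I)=+\infty$ when $I=R$. *)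

(* Defs.v *)
From HB Require Import structures.
From mathcomp Require Import all_boot all_order all_algebra.
(* mpoly has to be loaded before the classical files: the other order is
   rejected because of a notation level conflict. *)
From mathcomp Require Import mpoly.
From mathcomp Require Import boolp classical_sets constructive_ereal.

Set Implicit Arguments.
Unset Strict Implicit.
Unset Printing Implicit Defensive.

Import Order.TTheory GRing.Theory Num.Theory.

Local Open Scope classical_set_scope.
Local Open Scope ring_scope.

(* Finite sums of products c * g with c in S and g in A; the empty sum is
   allowed, so 0 always belongs to it. *)
Definition span (T : nzRingType) (S A : set T) : set T :=
  [set x | exists (m : nat) (c g : 'I_m -> T),
     [/\ forall i, S (c i), forall i, A (g i) & x = \sum_i c i * g i]].

Definition ideal_gen (T : nzRingType) (A : set T) : set T := span setT A.

(* I ^ 0 is the whole ring and I ^ k.+1 is the ideal product I * I ^ k. *)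
Definition ideal_pow (T : nzRingType) (I : set T) (k : nat) : set T :=
  iter k (span I) setT.

(* idealr_closed includes properness (1 is not in P). *)
Definition prime_ideal (T : nzRingType) (P : set T) : Prop :=
  idealr_closed [pred f | f \in P] /\ prime_idealr_closed [pred f | f \in P].

Definition minimal_primes (T : nzRingType) (I : set T) : set (set T) :=
  [set P | [/\ prime_ideal P, I `<=` P &
     forall Q, prime_ideal Q -> I `<=` Q -> Q `<=` P -> Q = P]].

(* T is a domain, so its localization at a prime P is realized as a subring of
   the fraction field. *)
Definition localization (T : idomainType) (P : set T) : set {fraction T} :=
  [set x | exists f s : T, ~ P s /\ x = tofrac f / tofrac s].

Definition ideal_loc (T : idomainType) (P J : set T) : set {fraction T} :=
  span (localization P) [set tofrac f | f in J].

(* If I is the whole ring there is no minimal prime, and the intersection is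
   the whole ring. *)
Definition symbolic_pow (T : idomainType) (I : set T) (k : nat) : set T :=
  \bigcap_(P in minimal_primes I) [set f | ideal_loc P (ideal_pow I k) (tofrac f)].

Section Monomial.
Variables (K : fieldType) (n : nat).
Implicit Type I : set {mpoly K[n]}.

Definition monomial_ideal (A : set 'X_{1..n}) : set {mpoly K[n]} :=
  ideal_gen [set 'X_[K, u] | u in A].

Definition squarefree_monomial_ideal I : Prop :=
  exists A : set 'X_{1..n},
    (forall u, A u -> forall i : 'I_n, (u i <= 1)%N) /\ I = monomial_ideal A.

(* g lists, without repetition, the exponents of a generating set of monomials
   of I that is minimal for inclusion. *)
Definition minimal_monomial_generators I (m : nat)
    (g : m.-tuple 'X_{1..n}) : Prop :=
  [/\ uniq g, I = monomial_ideal [set` g] &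
      forall A : set 'X_{1..n},
        A `<=` [set` g] -> I = monomial_ideal A -> A = [set` g]].

Definition exponent_mx (m : nat) (g : m.-tuple 'X_{1..n}) : 'M[nat]_(n, m) :=
  \matrix_(i, j) tnth g j i.

Definition feasible (m : nat) (M : 'M[nat]_(n, m)) : set 'cV[nat]_n :=
  [set z | forall j : 'I_m, (1 <= (M^T *m z) j ord0)%N].

Definition dot (a : 'X_{1..n}) (z : 'cV[nat]_n) : nat :=
  (\sum_(i < n) a i * z i ord0)%N.

(* The default value 0 is used only for V empty. *)
Definition nat_min (V : set nat) : nat :=
  xget 0%N [set v | V v /\ forall w, V w -> (v <= w)%N].

(* When g lists minimal monomial generators of I <> R, no generator is 1, so
   z = (1, .., 1) is feasible and the minimum is over a nonempty set. *)
Definition tau I (m : nat) (g : m.-tuple 'X_{1..n}) (a : 'X_{1..n}) :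
    \bar int :=
  if `[< I = setT >] then +oo%E
  else (Posz (nat_min [set dot a z | z in feasible (exponent_mx g)]))%:E.

End Monomial.

(* Main.v *)
(* The minimal primes of I are the ideals P_C = (x_i : i in C) for the minimal
   sets C of variables meeting every generator. By minimality of C and
   squarefreeness, each x_i with i in C divides some generator x_i s with s
   outside P_C, so I and P_C have the same localization at P_C; hence x^a lies
   in the k-th power of that localization iff the sum of a_i over C is at least
   k. The indicator of C is feasible, and the support of any feasible z
   contains a minimal C, whence a.z is at least the sum of a_i over C. *)
Require Import Defs.
From HB Require Import structures.
From mathcomp Require Import all_boot all_order all_algebra.
From mathcomp Require Import mpoly.
From mathcomp Require Import boolp classical_sets constructive_ereal.

Import Order.TTheory GRing.Theory.

Local Open Scope ring_scope.

(** * Prime ideals of a domain and ideals extended to a localization *)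

Section Ideals.
Set Implicit Arguments.
Unset Strict Implicit.
Local Open Scope classical_set_scope.
Variable T : idomainType.
Implicit Types (I J P : set T) (f g x y : T).

Lemma mem_spanM (R : nzRingType) (S A : set R) (x y : R) :
  S x -> A y -> Defs.span S A (x * y).
Proof.
by move=> Sx Ay; exists 1%N, (fun=> x), (fun=> y); split; rewrite ?big_ord1.
Qed.

Lemma prime_idealP P : prime_ideal P <->
  [/\ P 0, ~ P 1, forall a x y, P x -> P y -> P (a * x + y)
    & forall x y, P (x * y) -> P x \/ P y].
Proof.
split=> [[[P0 P1 PD] PM]|[P0 P1 PD PM]].
  split.
  - by move: P0; rewrite !inE.
  - by move=> /mem_set; apply/negP.
  - by move=> a x y /mem_set Px /mem_set Py; have := PD a x y Px Py; rewrite !inE.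
  - move=> x y /mem_set /PM /orP [] /=; rewrite inE; first by left.
    by right.
split; first split.
- by rewrite !inE.
- by apply/negP => /=; rewrite inE.
- by move=> a x y; rewrite !inE => Px Py; apply: PD.
- by move=> x y; rewrite !inE => /PM [] /mem_set ->; rewrite ?orbT.
Qed.

Lemma prime_idealMl P x y : prime_ideal P -> P y -> P (x * y).
Proof. by case/prime_idealP=> P0 _ PD _ Py; rewrite -[_ * _]addr0; apply: PD. Qed.

Lemma prime_ideal_sum P (J : Type) (r : seq J) (p : pred J) (F : J -> T) :
  prime_ideal P -> (forall j, p j -> P (F j)) -> P (\sum_(j <- r | p j) F j).
Proof.
case/prime_idealP=> P0 _ PD _ PF; elim/big_ind: _ => // x y Px Py.
by rewrite -[x]mul1r; apply: PD.
Qed.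

Lemma prime_ideal_prod P (J : Type) (r : seq J) (F : J -> T) :
  prime_ideal P -> P (\prod_(j <- r) F j) -> exists j, P (F j).
Proof.
case/prime_idealP=> _ P1 _ PM; elim: r => [|j r IHr].
  by rewrite big_nil.
by rewrite big_cons => /PM [Pj|//]; exists j.
Qed.

Lemma prime_ideal_exp P x e : prime_ideal P -> P (x ^+ e) -> (0 < e)%N /\ P x.
Proof.
case/prime_idealP=> _ P1 _ PM; elim: e => [|e IHe]; first by rewrite expr0.
by rewrite exprS => /PM [//|/IHe [_]].
Qed.

Lemma prime_ideal_gen_sub P (A : set T) :
  prime_ideal P -> A `<=` P -> ideal_gen A `<=` P.
Proof.
move=> prP AP _ [m [c [g [_ Ag ->]]]]; apply: prime_ideal_sum => // i _.
by apply: prime_idealMl => //; apply: AP.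
Qed.

Lemma tofrac_notin_neq0 P s : prime_ideal P -> ~ P s -> tofrac s != 0.
Proof.
move=> prP Ps; rewrite tofrac_eq0; apply/eqP => s0; apply: Ps; rewrite s0.
by case/prime_idealP: prP.
Qed.

Lemma mem_ideal_loc P J x s :
  prime_ideal P -> ~ P s -> J (s * x) -> ideal_loc P J (tofrac x).
Proof.
move=> prP Ps Jsx; have s0 := tofrac_notin_neq0 prP Ps.
have -> : tofrac x = tofrac 1 / tofrac s * tofrac (s * x).
  by rewrite tofrac1 mul1r tofracM mulKf.
by apply: mem_spanM; [exists 1, s|exists (s * x)].
Qed.

(** A finite sum of fractions has a common denominator, a product of elements outside [P] and so
    outside [P] by primality; injectivity of [tofrac] brings the equation back to [T]. Closure of
    [J] is asked for as plain implications, the form in which it is known for [var_pow C k]. *)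
Lemma ideal_loc_clear P J x :
    prime_ideal P ->
    (forall c y, J y -> J (c * y)) -> J 0 -> (forall y z, J y -> J z -> J (y + z)) ->
  ideal_loc P J (tofrac x) -> exists2 s, ~ P s & J (s * x).
Proof.
move=> prP JM J0 JD; have [_ P1 _ PM] := (prime_idealP _).1 prP.
case=> m [c [g [Pc Jg xE]]].
suff [s Ps [y Jy yE]] : exists2 s, ~ P s &
    exists2 y, J y & tofrac s * (\sum_(i < m) c i * g i) = tofrac y.
  exists s => //; move: yE; rewrite -xE -tofracM => /eqP.
  by rewrite tofrac_eq => /eqP ->.
apply: (big_ind (fun z => exists2 s, ~ P s &
                          exists2 y, J y & tofrac s * z = tofrac y)).
- by exists 1 => //; exists 0 => //; rewrite mulr0 tofrac0.
- move=> z1 z2 [s1 Ps1 [y1 Jy1 E1]] [s2 Ps2 [y2 Jy2 E2]].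
  exists (s1 * s2); first by move=> /PM [].
  exists (s2 * y1 + s1 * y2); first by apply: JD; apply: JM.
  by rewrite tofracD !tofracM -E1 -E2 mulrDr !mulrA [tofrac s2 * _]mulrC.
- move=> i _; have [f [s [Ps ->]]] := Pc i; have [y Jy <-] := Jg i.
  have s0 := tofrac_notin_neq0 prP Ps.
  exists s => //; exists (f * y); first exact: JM.
  by rewrite tofracM mulrA [tofrac f / _]mulrC mulVKf.
Qed.

Lemma ideal_loc_sub P (J1 J2 : set T) :
  J1 `<=` J2 -> ideal_loc P J1 `<=` ideal_loc P J2.
Proof.
move=> sJ _ [m [c [g [Pc J1g ->]]]]; exists m, c, g; split=> // i.
by have [y /sJ J2y <-] := J1g i; exists y.
Qed.

End Ideals.

(** * Monomials and the primes generated by variables *)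

Section Monomials.
Set Implicit Arguments.
Unset Strict Implicit.
Local Open Scope classical_set_scope.
Variables (K : fieldType) (n : nat).
Implicit Types (C D : {set 'I_n}) (u v : 'X_{1..n}) (f h : {mpoly K[n]}).
Implicit Types (I P : set {mpoly K[n]}) (A : set 'X_{1..n}) (k : nat).

Definition deg_in C u : nat := (\sum_(i in C) u i)%N.

Lemma deg_inD C u v : deg_in C (u + v)%MM = (deg_in C u + deg_in C v)%N.
Proof. by rewrite -big_split; apply: eq_bigr => i _; rewrite mnmDE. Qed.

Lemma deg_in_gt0P C u :
  reflect (exists2 i, i \in C & (0 < u i)%N) (0 < deg_in C u)%N.
Proof.
rewrite lt0n sum_nat_eq0 negb_forall; apply: (iffP existsP) => [[i]|[i iC ui]].
  by rewrite negb_imply -lt0n => /andP [iC ui]; exists i.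
by exists i; rewrite negb_imply iC -lt0n.
Qed.

Lemma deg_inU C i : deg_in C U_(i)%MM = (i \in C).
Proof.
rewrite /deg_in (eq_bigr (fun j => nat_of_bool (i == j))) => [|j _]; last exact: mnm1E.
rewrite big_mkcond (bigD1 i) //= eqxx big1 ?addn0 => [|j /negbTE ji].
  by case: (i \in C).
by rewrite eq_sym ji if_same.
Qed.

Lemma mnm_splitU u i : (0 < u i)%N -> exists v, u = (v + U_(i))%MM.
Proof.
move=> ui; exists (u - U_(i))%MM; rewrite submK //; apply/mnm_lepP => j.
by rewrite mnm1E; case: eqP => // <-.
Qed.

(* The [k]-th power of the prime ideal generated by the variables in [C]. *)
Definition var_pow C k : set {mpoly K[n]} :=
  [set f | forall u, f@_u != 0 -> (k <= deg_in C u)%N].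

Lemma var_pow0 C k : var_pow C k 0.
Proof. by move=> u; rewrite mcoeff0 eqxx. Qed.

Lemma var_powD C k f h : var_pow C k f -> var_pow C k h -> var_pow C k (f + h).
Proof.
move=> Wf Wh u; rewrite mcoeffD; case: (eqVneq f@_u 0) => [->|/Wf //].
by rewrite add0r; apply: Wh.
Qed.

Lemma var_powM C k l f h :
  var_pow C k f -> var_pow C l h -> var_pow C (k + l) (f * h).
Proof.
move=> Wf Wh u; rewrite mcoeffM; apply: contraNT => ltu; apply/eqP.
apply: big1 => -[v w] /= /eqP uE.
case: (eqVneq f@_v 0) => [->|/Wf lev]; first by rewrite mul0r.
case: (eqVneq h@_w 0) => [->|/Wh lew]; first by rewrite mulr0.
by case/negP: ltu; rewrite [in X in (_ <= X)%N]uE deg_inD leq_add.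
Qed.

Lemma var_powMl C k f h : var_pow C k h -> var_pow C k (f * h).
Proof. by rewrite -[k in var_pow C k (_ * _)]add0n => Wh; apply: var_powM. Qed.

Lemma var_powX C k u : var_pow C k 'X_[u] <-> (k <= deg_in C u)%N.
Proof.
split=> [|le_k v]; first by apply; rewrite mcoeffX eqxx oner_eq0.
by rewrite mcoeffX; case: (u =P v) => [<-|]; rewrite ?eqxx.
Qed.

(** A ring morphism into a domain with kernel [var_pow C 1]; it serves to show that this ideal is
    prime. *)
Definition kill_vars C : {mpoly K[n]} -> {mpoly K[n]} :=
  mmap (@mpolyC n K) (fun i => if i \in C then 0 else 'X_i).

Lemma mcoeff_kill_vars C f u :
  (kill_vars C f)@_u = if deg_in C u == 0%N then f@_u else 0.
Proof.
(* The morphism fixes a monomial free of the variables in [C] and sends any other to 0. *)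
transitivity (\sum_(v <- msupp f) f@_v * (v == u)%:R * (deg_in C u == 0%N)%:R).
  rewrite /kill_vars /mmap raddf_sum; apply: eq_bigr => v _ /=.
  rewrite mcoeffCM -mulrA; congr (_ * _).
  have [v0|] := eqVneq (deg_in C v) 0%N.
    have -> : mmap1 (fun i => if i \in C then 0 else 'X_i) v = 'X_[K, v].
      rewrite mpolyXE_id; apply: eq_bigr => i _; case: ifP => // iC.
      move/eqP: v0; rewrite sum_nat_eq0 => /forallP /(_ i).
      by rewrite iC => /eqP ->; rewrite !expr0.
    by rewrite mcoeffX; case: eqP => [<-|]; rewrite ?v0 ?mulr1 ?mul0r.
  rewrite -lt0n => v_gt0; have /deg_in_gt0P [i iC vi] := v_gt0.
  have -> : mmap1 (fun i => if i \in C then 0 else 'X_i) v = 0 :> {mpoly K[n]}.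
    by rewrite /mmap1 (bigD1 i) //= iC expr0n -[_ == _]negbK -lt0n vi mul0r.
  rewrite mcoeff0; case: eqP => [<-|]; last by rewrite mul0r.
  by rewrite eqn0Ngt v_gt0 mulr0.
rewrite -mulr_suml; have -> : \sum_(v <- msupp f) f@_v * (v == u)%:R = f@_u.
  rewrite [RHS](congr1 (mcoeff u) (mpolyE f)) raddf_sum /=.
  by apply: eq_bigr => v _; rewrite mcoeffZ mcoeffX.
by case: eqP; rewrite ?mulr1 ?mulr0.
Qed.

Lemma kill_vars_eq0 C f : kill_vars C f = 0 <-> var_pow C 1 f.
Proof.
split=> [f0 u fu|Wf].
  rewrite lt0n; apply: contraNneq fu => u0; move/(congr1 (mcoeff u)): f0.
  by rewrite mcoeff_kill_vars u0 eqxx mcoeff0 => ->.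
apply/mpolyP => u; rewrite mcoeff_kill_vars mcoeff0; case: eqP => // u0.
by apply: contraTeq isT => /Wf; rewrite u0.
Qed.

Lemma prime_var_pow C : prime_ideal (var_pow C 1).
Proof.
apply/prime_idealP; split.
- exact: var_pow0.
- by rewrite -mpolyX0 => /var_powX; rewrite /deg_in big1 // => i _; rewrite mnm0E.
- by move=> c f h Wf Wh; apply: var_powD => //; apply: var_powMl.
- move=> f h /kill_vars_eq0 /eqP.
  rewrite /kill_vars rmorphM mulf_eq0 => /orP [] /eqP /kill_vars_eq0; first by left.
  by right.
Qed.

Lemma prime_ideal_mono P u :
  prime_ideal P -> P 'X_[K, u] -> exists2 i, (0 < u i)%N & P 'X_i.
Proof.
move=> prP; rewrite mpolyXE_id => /(prime_ideal_prod prP) [i].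
by case/(prime_ideal_exp prP) => ui Pi; exists i.
Qed.

Lemma var_pow_sub_prime P C :
  prime_ideal P -> (forall i, i \in C -> P 'X_i) -> var_pow C 1 `<=` P.
Proof.
move=> prP CP f Wf; rewrite [f]mpolyE big_seq; apply: prime_ideal_sum => // u.
rewrite mcoeff_msupp => /Wf /deg_in_gt0P [i iC /mnm_splitU [v ->]].
by rewrite mpolyXD -mul_mpolyC mulrA; apply: prime_idealMl => //; apply: CP.
Qed.

(** * Minimal primes of a monomial ideal *)

Definition var_support P : {set 'I_n} := [set i | `[< P 'X_i >]]%SET.

Lemma var_supportP P i : reflect (P 'X_i) (i \in var_support P).
Proof. by rewrite inE; apply: asboolP. Qed.

(** A prime containing a monomial contains one of the variables dividing it, so each generator is
    divisible by a variable lying in [P]. *)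
Lemma monomial_ideal_sub_var_pow A P :
  prime_ideal P -> monomial_ideal A `<=` P ->
  monomial_ideal A `<=` var_pow (var_support P) 1.
Proof.
move=> prP AP; apply: prime_ideal_gen_sub; first exact: prime_var_pow.
move=> _ [u Au <-]; apply/var_powX/deg_in_gt0P.
have /AP Pu : monomial_ideal A 'X_[K, u].
  by rewrite -['X_[u]]mul1r; apply: mem_spanM => //; exists u.
by have [i ui /var_supportP Pi] := prime_ideal_mono prP Pu; exists i.
Qed.

Lemma minimal_prime_var_pow A P :
  minimal_primes (monomial_ideal A) P -> P = var_pow (var_support P) 1.
Proof.
case=> prP AP minP; apply/esym/minP; first exact: prime_var_pow.
  exact: monomial_ideal_sub_var_pow.
by apply: var_pow_sub_prime => // i /var_supportP.
Qed.

(** Take [D] inclusion-minimal among the subsets of [C] whose prime contains the ideal. A prime [Q]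
    between the ideal and [var_pow D 1] has its variables in [D], and they already define such a
    prime, so they are all of [D]. *)
Lemma exists_minimal_prime_var_pow A C : monomial_ideal A `<=` var_pow C 1 ->
  exists2 D : {set 'I_n}, D \subset C & minimal_primes (monomial_ideal A) (var_pow D 1).
Proof.
move=> AC; pose cover (D : {set 'I_n}) := `[< monomial_ideal A `<=` var_pow D 1 >].
have [|D /minsetP [/asboolP AD minD] DC] := @minset_exists _ cover C.
  exact/asboolP.
exists D => //; split=> // [|Q prQ AQ QD]; first exact: prime_var_pow.
have DE : var_support Q = D.
  apply: minD; first exact/asboolP/monomial_ideal_sub_var_pow.
  apply/fintype.subsetP => i /var_supportP /QD /var_powX.
  by rewrite deg_inU; case: (i \in D).
apply/seteqP; split=> //; rewrite -{1}DE.
by apply: var_pow_sub_prime => // i /var_supportP.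
Qed.

(** * Powers of the ideal, locally at a minimal prime *)

Lemma ideal_pow_sub_var_pow I C k :
  I `<=` var_pow C 1 -> ideal_pow I k `<=` var_pow C k.
Proof.
move=> IC; elim: k => [//|k IHk] _ [m [c [g [Ic Ig ->]]]].
apply: (big_ind (var_pow C k.+1)) => [|f h|i _].
- exact: var_pow0.
- exact: var_powD.
- by rewrite -add1n; apply: var_powM (IC _ (Ic i)) (IHk _ (Ig i)).
Qed.

Lemma symbolic_pow_deg_in I C k u :
  symbolic_pow I k 'X_[K, u] -> minimal_primes I (var_pow C 1) ->
  (k <= deg_in C u)%N.
Proof.
move=> Iu minC; have [prC IC _] := minC.
have /= loc_u := ideal_loc_sub (ideal_pow_sub_var_pow (k := k) IC) (Iu _ minC).
have [s Cs Ws] :=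
  ideal_loc_clear prC (@var_powMl C k) (@var_pow0 C k) (@var_powD C k) loc_u.
(* Since [s] is outside the prime, it has a monomial [v] free of the variables in [C]. Then [u + v]
   occurs in [s * 'X_[u]] and has the same degree in [C] as [u]. *)
have /existsNP [v] : ~ forall v, s@_v != 0 -> (0 < deg_in C v)%N := Cs.
move=> /not_implyP [sv /negP]; rewrite -eqn0Ngt => /eqP v0.
by have := Ws (u + v)%MM; rewrite mcoeffMX deg_inD v0 addn0 => /(_ sv).
Qed.

(* If every generator through [i] met [C] elsewhere too, [C] minus [i] would
   define a smaller prime over the ideal. *)
Lemma minimal_prime_local_var A C i :
    (forall u, A u -> forall j, (u j <= 1)%N) ->
    minimal_primes (monomial_ideal A) (var_pow C 1) -> i \in C ->
  exists2 s, ~ var_pow C 1 s & monomial_ideal A (s * 'X_i).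
Proof.
move=> sqfA [prC AC minC] iC.
(* A generator that meets [C] at most in [i]. *)
have [u Au Cu0] : exists2 u, A u & deg_in (C :\ i) u = 0%N.
  apply: contrapT => noA.
  have CE : var_pow (C :\ i) 1 = var_pow C 1.
    apply: minC; first exact: prime_var_pow.
    - apply: prime_ideal_gen_sub; first exact: prime_var_pow.
      move=> _ [u Au <-]; apply/var_powX; rewrite lt0n; apply/eqP => u0.
      by apply: noA; exists u.
    - apply: var_pow_sub_prime => // j; rewrite in_setD1 => /andP [_ jC].
      by apply/var_powX; rewrite deg_inU jC.
  have : var_pow (C :\ i) 1 'X_i.
    by rewrite CE; apply/var_powX; rewrite deg_inU iC.
  by move/var_powX; rewrite deg_inU in_setD1 eqxx.
have IX : monomial_ideal A 'X_[K, u].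
  by rewrite -['X_[u]]mul1r; apply: mem_spanM => //; exists u.
have degC v : deg_in C v = (v i + deg_in (C :\ i) v)%N by rewrite /deg_in (big_setD1 i).
have /var_powX := AC _ IX; rewrite degC Cu0 addn0 => /mnm_splitU [v uE].
exists 'X_[v]; last by rewrite -mpolyXD -uE.
move/var_powX; apply/negP; rewrite -eqn0Ngt degC addn_eq0.
(* Squarefreeness leaves no [i] in the cofactor [v], so [v] avoids all of [C]. *)
move: (sqfA u Au i) Cu0; rewrite uE mnmDE mnm1E eqxx addn1 ltnS leqn0 => ->.
by rewrite deg_inD => /eqP; rewrite addn_eq0 => /andP [].
Qed.

(** Peel off one variable of [C] at a time: each is brought into the ideal by a multiplier outside
    the prime, and the product of the [k] multipliers stays outside. *)
Lemma ideal_pow_local_mono A C k u :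
    (forall u, A u -> forall j, (u j <= 1)%N) ->
    minimal_primes (monomial_ideal A) (var_pow C 1) -> (k <= deg_in C u)%N ->
  exists2 s, ~ var_pow C 1 s & ideal_pow (monomial_ideal A) k (s * 'X_[u]).
Proof.
move=> sqfA minC; have [prC _ _] := minC.
have [_ C1 _ CM] := (prime_idealP _).1 prC.
elim: k u => [|k IHk] u leu; first by exists 1.
have /deg_in_gt0P [i iC /mnm_splitU [v uE]] : (0 < deg_in C u)%N.
  by apply: leq_trans leu.
have [s Cs Is] := minimal_prime_local_var sqfA minC iC.
have [|t Ct It] := IHk v.
  by move: leu; rewrite uE deg_inD deg_inU iC addn1.
exists (s * t); first by move=> /CM [].
by rewrite uE mpolyXD [X in _ * X]mulrC mulrACA; apply: mem_spanM.
Qed.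

(** * Feasible vectors as covers of the generators *)

(** All terms are natural numbers, so a coordinate of the product is positive exactly when the
    support of [z] meets that generator; only the support of [z] matters. *)
Lemma feasibleP m (g : m.-tuple 'X_{1..n}) (z : 'cV[nat]_n) :
  feasible (exponent_mx g) z <->
  monomial_ideal [set` g] `<=` var_pow [set i | (0 < z i ord0)%N]%SET 1.
Proof.
have zE j : (0 < ((exponent_mx g)^T *m z) j ord0)%N =
            (0 < deg_in [set i | (0 < z i ord0)%N]%SET (tnth g j))%N.
  have -> : ((exponent_mx g)^T *m z) j ord0 = (\sum_i tnth g j i * z i ord0)%N.
    by rewrite mxE; apply: eq_bigr => i _; rewrite !mxE.
  rewrite lt0n sum_nat_eq0 negb_forall; apply/existsP/deg_in_gt0P => -[i].
    by rewrite -lt0n muln_gt0 => /andP [gi zi]; exists i; rewrite ?inE.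
  by rewrite inE => zi gi; exists i; rewrite -lt0n muln_gt0 gi.
split=> [fz|gz j]; last first.
  rewrite zE; apply/(var_powX _ 1)/gz.
  rewrite -['X_[_]]mul1r; apply: mem_spanM => //; exists (tnth g j) => //.
  exact: mem_tnth.
apply: prime_ideal_gen_sub; first exact: prime_var_pow.
move=> _ [_ /tnthP [j ->] <-]; apply/var_powX; rewrite -zE; exact: fz.
Qed.

End Monomials.

(** * Comparison of the symbolic power with the minimum *)

(** Nonemptiness excludes the default value 0, for which the right side would hold vacuously for
    every [k]. *)
Lemma leq_nat_min (V : set nat) (k : nat) :
  (V !=set0)%classic -> (k <= nat_min V)%N <-> forall w, V w -> (k <= w)%N.
Proof.
case=> w0 Vw0; have exV : exists v, `[< V v >] by exists w0; apply/asboolP.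
have [Vm minV] : [set v | V v /\ forall w, V w -> (v <= w)%N]%classic (nat_min V).
  apply: (@xgetPex _ 0%N); case: (ex_minnP exV) => v /asboolP Vv minv.
  by exists v; split=> // w /asboolP /minv.
by split=> [lek w /minV|]; [apply: leq_trans|apply].
Qed.

Theorem proposition1p5 (K : fieldType) (n : nat) (I : set {mpoly K[n]})
    (m : nat) (g : m.-tuple 'X_{1..n}) (a : 'X_{1..n}) (k : nat)
    (sqfree_I : squarefree_monomial_ideal I)
    (gens_g : minimal_monomial_generators I g)
    (k_gt0 : (0 < k)%N) :
  symbolic_pow I k 'X_[K, a] <-> ((Posz k)%:E <= tau I g a)%E.
Proof.
(* Two generating sets of [I] are in play: [A] carries squarefreeness, [g] gives the matrix. *)
have [A [sqfA IA]] := sqfree_I; have [_ Ig _] := gens_g.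
rewrite /tau; case: asboolP => [IT|InT].
  (* For the unit ideal both sides hold: the minimum is infinite and no proper prime contains
     [I]. *)
  split=> [_|_ P [/prime_idealP [_ P1 _ _] IP _]]; first exact: leey.
  by case: P1; apply: IP; rewrite IT.
rewrite lee_fin lez_nat leq_nat_min; last first.
  (* The all-ones vector is feasible: a generator it misses would be 1, forcing [I] to be the whole
     ring. *)
  exists (dot a (const_mx 1%N)), (const_mx 1%N) => //; apply/(feasibleP K).
  apply: prime_ideal_gen_sub; first exact: prime_var_pow.
  move=> _ [u gu <-]; apply/var_powX; apply: contra_notT InT => u0.
  have {}u0 : u = 0%MM.
    apply/mnmP => i; rewrite mnm0E; apply: contraNeq u0; rewrite -lt0n => ui.
    by apply/deg_in_gt0P; exists i => //; rewrite inE mxE.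
  apply/seteqP; split=> // f _; rewrite Ig -[f]mulr1 -mpolyX0.
  by apply: mem_spanM => //; exists u => //; rewrite u0.
split=> [Ia _ [z fz <-]|tau_k P].
  (* On [D], inside the support of [z], every coordinate of [z] is at least 1, so [dot a z] is at
     least [deg_in D a]. *)
  have /exists_minimal_prime_var_pow [D Dz] := (feasibleP K g z).1 fz.
  rewrite -Ig => /(symbolic_pow_deg_in Ia) /leq_trans; apply.
  rewrite /deg_in big_mkcond; apply: leq_sum => i _; case: ifP => // iD.
  by move/fintype.subsetP: Dz => /(_ i iD); rewrite inE => zi; rewrite leq_pmulr.
move=> minP; have [prP _ _] := minP.
(* The indicator of the variables in [P] is feasible, and its value is exactly the degree of [a] in
   them. *)
pose z : 'cV[nat]_n := \col_i nat_of_bool (i \in var_support P).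
have PE : P = var_pow (var_support P) 1.
  by apply: (minimal_prime_var_pow (A := A)); rewrite -IA.
have zE : [set i | (0 < z i ord0)%N]%SET = var_support P.
  by apply/setP => i; rewrite inE mxE lt0b.
have degP : (k <= deg_in (var_support P) a)%N.
  have -> : deg_in (var_support P) a = dot a z.
    rewrite /deg_in big_mkcond; apply: eq_bigr => i _; rewrite mxE.
    by case: (i \in _); rewrite ?muln1 ?muln0.
  apply: tau_k; exists z => //; apply/(feasibleP K); rewrite zE -PE -Ig.
  by case: minP.
have minA : minimal_primes (@monomial_ideal K n A) (var_pow (var_support P) 1).
  by rewrite -PE -IA.
have [s] := ideal_pow_local_mono sqfA minA degP.
by rewrite -PE -IA; apply: mem_ideal_loc.
Qed.
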